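(* Let $(M^3,g)$ be a 3-dimensional complete connected smooth Riemannian manifold without boundary that is isometric to a Riemannian product $N\times\mathbb{R}$. Let $f:M^3\to\mathbb{R}$ be a non-trivial affine function and let $\alpha=\alpha(s)$ be an $f$-eikonal slant helix curve in $M^3$ with Frenet frame $\{T,N,B\}$, curvature $\kappa$ and torsion $\tau$. Write $\cos\theta=g(\nabla f,N)$, which is a non-zero constant along $\alpha$. Then the following hold. (i) The function $$\frac{\kappa^2}{(\tau^2+\kappa^2)^{3/2}}\left(\frac{\tau}{\kappa}\right)'$$ is a real constant (along $\alpha$). (ii) The axis of the $f$-eikonal slant helix is $$\nabla f=\frac{n\tau}{\sqrt{\tau^2+\kappa^2}}\,T+\cos\theta\, N+\frac{n\kappa}{\sqrt{\tau^2+\kappa^2}}\,B$$ along $\alpha$, where $n$ is a non-zero constant.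
   Context: $\alpha:I\subset\mathbb{R}\to M^3$ is an immersed curve parametrized by arc length $s$, with Frenet frame $\{T,N,B\}$, curvature $\kappa>0$ and torsion $\tau$; with $\nabla$ the Levi-Civita connection of $M^3$, the Frenet equations are $\nabla_TT=\kappa N$, $\nabla_TN=-\kappa T+\tau B$, $\nabla_TB=-\tau N$. The prime denotes $d/ds$. For a function $f$, $\nabla f$ denotes its gradient, $df(X)=g(\nabla f,X)$. (In the frame, $N$ is the principal normal; in the product $N\times\mathbb{R}$, $N$ is a manifold.) A function $f:M^3\to\mathbb{R}$ is affine if its restriction to every geodesic is an affine function of the affine parameter; on a complete connected smooth Riemannian manifold this is equivalent to $f$ being smooth with parallel gradient $\nabla f$. Non-trivial means non-constant. $f$ is eikonal along $\alpha$ if $\|\nabla f\|$ is constant along $\alpha$. If $f$ is eikonal along the Frenet curve $\alpha$ and the function $g(\nabla f,N)$ is a non-zero constant along $\alpha$, then $\alpha$ is called an $f$-eikonal slant helix curve, and $\nabla f$ is called its axis. *)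

(* Defs.v *)
From HB Require Import structures.
From mathcomp Require Import all_boot all_order all_algebra.
From mathcomp Require Import all_classical all_reals all_analysis.

Set Implicit Arguments.
Unset Strict Implicit.
Unset Printing Implicit Defensive.

Import Order.TTheory GRing.Theory Num.Theory.
Import numFieldNormedType.Exports.

Local Open Scope classical_set_scope.
Local Open Scope ring_scope.

Section Smooth.
Context {R : realType} {E F : normedModType R}.

(* [U] is meant to be open: differentiability is not relative to [U]. *)
Fixpoint Ck_on (k : nat) (U : set E) (f : E -> F) : Prop :=
  if k is k'.+1 then
    (forall x, U x -> differentiable f x) /\ (forall v, Ck_on k' U ('D_v f))
  else forall x, U x -> {for x, continuous f}.

Definition smooth_on (U : set E) (f : E -> F) : Prop :=
  forall k, Ck_on k U f.

End Smooth.

(* [chart_coord] is relevant on [chart_dom] only, and its inverse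
   [chart_param] on the image of [chart_dom] only. *)
Record chart (R : realType) (n : nat) (M : topologicalType) := Chart {
  chart_dom : set M;
  chart_coord : M -> 'rV[R]_n;
  chart_param : 'rV[R]_n -> M
}.

(* The data of a manifold with a metric: an atlas indexed by the points, whose
   chart [chart_at p] is around [p], and a Gram matrix at every point.  The
   tangent space at [p] is ['rV_n], a vector being given by its components in
   the chart [chart_at p]; [metric p] is the matrix of the inner product in
   these components. *)
Record riemannian (R : realType) (n : nat) (M : topologicalType) := Riemannian {
  chart_at : M -> chart R n M;
  metric : M -> 'M[R]_n
}.

Section Riemannian.
Context {R : realType} {n : nat} {M : topologicalType}.
Variable S : riemannian R n M.
Implicit Types p q : M.

Definition dom p : set M := chart_dom (chart_at S p).
Definition coord p : M -> 'rV[R]_n := chart_coord (chart_at S p).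
Definition param p : 'rV[R]_n -> M := chart_param (chart_at S p).
Definition coord_dom p : set 'rV[R]_n := coord p @` dom p.

Definition inner p (u v : 'rV[R]_n) : R := (u *m metric S p *m v^T) 0 0.

(* [to_chart p q u]: components in the chart [chart_at p] of the tangent
   vector [u] at [q]; [of_chart p q w]: the tangent vector at [q] with
   components [w] in the chart [chart_at p]. *)
Definition to_chart p q (u : 'rV[R]_n) : 'rV[R]_n :=
  'd (coord p \o param q) (coord q q) u.
Definition of_chart p q (w : 'rV[R]_n) : 'rV[R]_n :=
  'd (coord q \o param p) (coord p q) w.

(* The matrix (g_ij) of the metric in the chart [chart_at p]. *)
Definition gram p (x : 'rV[R]_n) : 'M[R]_n :=
  \matrix_(i, j) inner (param p x) (of_chart p (param p x) (delta_mx 0 i))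
                                   (of_chart p (param p x) (delta_mx 0 j)).

Definition is_chart (c : chart R n M) : Prop :=
  [/\ open (chart_dom c), open (chart_coord c @` chart_dom c),
      (forall p, chart_dom c p -> chart_param c (chart_coord c p) = p),
      (forall p, chart_dom c p -> {for p, continuous (chart_coord c)}) &
      (forall x, (chart_coord c @` chart_dom c) x ->
         {for x, continuous (chart_param c)})].

Definition smooth_atlas : Prop :=
  [/\ forall p, is_chart (chart_at S p), forall p, dom p p &
      forall p q, smooth_on (coord p @` (dom p `&` dom q))
                            (coord q \o param p)].

Definition riemannian_metric : Prop :=
  [/\ forall p, (metric S p)^T = metric S p,
      forall p u, u != 0 -> 0 < inner p u u &
      forall p, smooth_on (coord_dom p) (gram p)].

Definition riemannian_manifold : Prop :=
  [/\ hausdorff_space M, second_countable (T := M),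
      smooth_atlas & riemannian_metric].

Definition smooth_function (f : M -> R) : Prop :=
  forall p, smooth_on (coord_dom p) (f \o param p).

Definition dfun (f : M -> R) p (u : 'rV[R]_n) : R :=
  'd (f \o param p) (coord p p) u.

Definition grad (f : M -> R) p : 'rV[R]_n :=
  xget 0 [set w | forall u, dfun f p u = inner p w u].

(* Curves and fields along them are total functions, considered on an open
   interval [I] only. *)
Definition open_interval (I : set R) : Prop :=
  [/\ open I, is_interval I & I !=set0].

Definition smooth_curve (I : set R) (c : R -> M) : Prop :=
  (forall t, I t -> {for t, continuous c}) /\
  (forall p, smooth_on (I `&` c @^-1` dom p) (coord p \o c)).

Definition velocity (c : R -> M) (t : R) : 'rV[R]_n :=
  derive1 (coord (c t) \o c) t.

Definition smooth_field (I : set R) (c : R -> M) (V : R -> 'rV[R]_n) : Prop :=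
  forall p, smooth_on (I `&` c @^-1` dom p) (fun t => to_chart p (c t) (V t)).

(* The Christoffel symbols of the Levi-Civita connection in the chart
   [chart_at p]; [k] is the upper index. *)
Definition christoffel p (x : 'rV[R]_n) (k i j : 'I_n) : R :=
  let d (l a b : 'I_n) := 'D_(delta_mx 0 l) (fun y => gram p y a b) x in
  2^-1 * \sum_l invmx (gram p x) k l * (d i j l + d j i l - d l i j).

(* The Levi-Civita covariant derivative of [V] along [c], computed in the
   chart at [c t]. *)
Definition covd (c : R -> M) (V : R -> 'rV[R]_n) (t : R) : 'rV[R]_n :=
  let p := c t in
  derive1 (fun s => to_chart p (c s) (V s)) t +
  \row_k \sum_i \sum_j
    christoffel p (coord p p) k i j * velocity c t 0 i * V t 0 j.

Definition geodesic (J : set R) (c : R -> M) : Prop :=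
  [/\ open_interval J, smooth_curve J c &
      forall t, J t -> covd c (velocity c) t = 0].

(* Geodesic completeness: every exponential map is defined on the whole
   tangent space. *)
Definition complete_riemannian : Prop :=
  forall p u, exists c : R -> M,
    [/\ geodesic [set: R] c, c 0 = p & velocity c 0 = u].

Definition affine_function (f : M -> R) : Prop :=
  forall J c, geodesic J c ->
    exists a b : R, forall t, J t -> f (c t) = a * t + b.

Definition nontrivial_function (f : M -> R) : Prop :=
  exists p q, f p <> f q.

Definition frenet_curve (I : set R) (alpha : R -> M)
    (T N B : R -> 'rV[R]_n) (kappa tau : R -> R) : Prop :=
  [/\ open_interval I /\ smooth_curve I alpha,
      forall s, I s -> T s = velocity alpha s,
      [/\ smooth_field I alpha T, smooth_field I alpha N &
          smooth_field I alpha B],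
      forall s, I s ->
        let g := inner (alpha s) in
        [/\ g (T s) (T s) = 1, g (N s) (N s) = 1 & g (B s) (B s) = 1] /\
        [/\ g (T s) (N s) = 0, g (T s) (B s) = 0 & g (N s) (B s) = 0] &
      forall s, I s ->
        [/\ 0 < kappa s,
            covd alpha T s = kappa s *: N s,
            covd alpha N s = - kappa s *: T s + tau s *: B s &
            covd alpha B s = - tau s *: N s]].

Definition eikonal_along (f : M -> R) (I : set R) (alpha : R -> M) : Prop :=
  exists m : R, forall s, I s ->
    Num.sqrt (inner (alpha s) (grad f (alpha s)) (grad f (alpha s))) = m.

(* [N] is meant to be the principal normal of the Frenet curve [alpha]. *)
Definition eikonal_slant_helix (f : M -> R) (I : set R) (alpha : R -> M)
    (N : R -> 'rV[R]_n) : Prop :=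
  eikonal_along f I alpha /\
  exists c : R, c != 0 /\
    forall s, I s -> inner (alpha s) (grad f (alpha s)) (N s) = c.

End Riemannian.

Section Maps.
Context {R : realType} {n : nat}.

Definition smooth_map {M M' : topologicalType} (S : riemannian R n M)
    (S' : riemannian R n M') (F : M -> M') : Prop :=
  continuous F /\
  forall p q, smooth_on (coord S p @` (dom S p `&` F @^-1` dom S' q))
                        (coord S' q \o F \o param S p).

Definition tangent_map {M M' : topologicalType} (S : riemannian R n M)
    (S' : riemannian R n M') (F : M -> M') (p : M) (u : 'rV[R]_n) : 'rV[R]_n :=
  'd (coord S' (F p) \o F \o param S p) (coord S p p) u.

Definition isometric {M M' : topologicalType} (S : riemannian R n M)
    (S' : riemannian R n M') : Prop :=
  exists (F : M -> M') (G : M' -> M),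
    [/\ cancel F G, cancel G F, smooth_map S S' F, smooth_map S' S G &
        forall p u v,
          inner S' (F p) (tangent_map S S' F p u) (tangent_map S S' F p v)
          = inner S p u v].

End Maps.

(* The Riemannian product of [S] with the real line. *)
Definition prod_line {R : realType} {n : nat} {N : topologicalType}
    (S : riemannian R n N) : riemannian R (n + 1) (N * R)%type :=
  {| chart_at := fun p => {|
       chart_dom := dom S p.1 `*` [set: R];
       chart_coord := fun q => row_mx (coord S p.1 q.1) (q.2)%:M;
       chart_param := fun x => (param S p.1 (lsubmx x), rsubmx x 0 0) |};
     metric := fun p => block_mx (metric S p.1) 0 0 1%:M |}.

(* Main.v *)
Require Import Defs.
From HB Require Import structures.
From mathcomp Require Import all_boot all_order all_algebra.
From mathcomp Require Import all_classical all_reals all_analysis.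
From mathcomp Require Import ring lra.
Import Order.TTheory GRing.Theory Num.Theory.
Import numFieldNormedType.Exports.
Import Defs.

Local Open Scope classical_set_scope.
Local Open Scope ring_scope.

(** An affine function [f] has vanishing Hessian: its restriction to the geodesic
    through [p] with velocity [u] has zero second derivative, and this derivative is
    the Hessian of [f] at [p] on the pair [(u, u)]; completeness provides a geodesic
    for every [u], and the Hessian is symmetric because second derivatives and the
    Christoffel symbols are ([derive_sym], [affine_hessian0]).  Hence [grad f] is
    parallel along every curve ([is_derive_inner_grad]).

    Let [a], [c], [b] be the components of [grad f] on [T], [N], [B].  The Frenet
    equations become [a' = kappa c], [c' = - kappa a + tau b] and [b' = - tau c].  On
    a slant helix [c] is a non-zero constant, so [kappa a = tau b], and therefore
    [(a^2 + b^2)' = 2 c (kappa a - tau b) = 0].  So [(a, b)] is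
    [n (tau, kappa) / sqrt (tau^2 + kappa^2)] with [n^2] constant; [n] cannot vanish,
    since then [a] would, against [a' = kappa c <> 0], and by connectedness of the
    interval it keeps its sign.  Finally [tau / kappa = a / b] has derivative
    [c (kappa b + tau a) / b^2 = c (tau^2 + kappa^2)^(3/2) / (n kappa^2)], so that the
    function of (i) is the constant [c / n] ([slant_helix_ode]).

    The derivative of [g (grad f, V)] along a curve [c] is computed near each instant
    [s] in the single chart at [c s], which is where [covd] and the Hessian are
    expressed ([is_derive_dfun]). *)

(** * Directional derivatives *)

Section Calculus.
Context {R : realType}.

Lemma is_derive_line {V : normedModType R} {F : V -> R} {y u : V} {t : R} :
  differentiable F (y + t *: u) ->
  is_derive t (1 : R) (fun r => F (y + r *: u)) ('D_u F (y + t *: u)).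
Proof.
move=> dF.
have dl : is_diff t (fun r : R => y + r *: u) (fun r : R => r *: u).
  by apply: (is_diff_eq _ (add0r _)).
have dc : differentiable (F \o (fun r : R => y + r *: u)) t.
  by apply: differentiable_comp => //; exact: ex_diff.
apply: DeriveDef; first exact: diff_derivable.
by rewrite deriveE// diff_comp//= diff_val scale1r deriveE.
Qed.

Lemma is_derive_continuous (g : R -> R) (s d : R) :
  is_derive s (1 : R) g d -> {for s, continuous g}.
Proof.
by move=> [dg _]; apply/differentiable_continuous/derivable1_diffP.
Qed.

(** With the mean value theorem along [u], the second difference over the
    parallelogram spanned by [h *: u] and [h *: v] is [h] times a difference of
    two values of ['D_u F], and the differentiability of ['D_u F] at [x] alone
    evaluates that difference up to [o(h)]. *)
Lemma second_difference {V : normedModType R} {F : V -> R} {x u v : V} :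
  (\forall z \near x, differentiable F z) -> differentiable ('D_u F) x ->
  forall e, 0 < e -> \forall h \near (0 : R)^'+,
    `|(F (x + h *: u + h *: v) - F (x + h *: v))
      - (F (x + h *: u) - F x) - h ^+ 2 * 'D_v ('D_u F) x| <= e * h ^+ 2.
Proof.
move=> /nbhs_ballP[d1 /= d10 dF] dDF e e0.
(* Both values of ['D_u F] are taken within [h * (`|u| + `|v|)] of [x]: the
   two errors add up to at most [h * C] times the tolerance [e / C]. *)
set C := (`|u| + `|v|) * 2 + 1.
have C0 : 0 < C by rewrite ltr_wpDl// mulr_ge0// addr_ge0.
have e'0 : 0 < e / C by rewrite divr_gt0.
have /eqaddoP/(_ _ e'0)/nbhs_ballP[d2 /= d20 Ho] := diff_locally dDF.
set G := 'D_u F in dDF Ho *; set L := 'd G x in Ho.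
have Gerr z : `|z| < d2 -> `|G (x + z) - G x - L z| <= e / C * `|z|.
  move=> zd; have := Ho z; rewrite -ball_normE /ball_ /= sub0r normrN => /(_ zd).
  by rewrite /= !fctE /= [z + x]addrC opprD addrA.
have hC0 : 0 < Num.min d1 d2 / C by rewrite divr_gt0// lt_min d10.
near=> h.
have h0 : 0 < h by [].
have hd : h * C < Num.min d1 d2.
  by rewrite -ltr_pdivlMr//; near: h; exact: nbhs_right_lt.
have bnd t : 0 <= t <= h -> forall w, `|w| <= `|v| ->
    `|t *: u + h *: w| <= h * (`|u| + `|v|).
  move=> /andP[t0 th] w wv; rewrite (le_trans (ler_normD _ _))// !normrZ mulrDr.
  by rewrite !ger0_norm// ?(ltW h0)// lerD// ?ler_wpM2r// ler_wpM2l// ltW.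
have small t : 0 <= t <= h -> forall w, `|w| <= `|v| ->
    `|t *: u + h *: w| < Num.min d1 d2.
  move=> /bnd th w /th /le_lt_trans; apply; apply: le_lt_trans hd.
  rewrite ler_pM2l// /C.
  have := normr_ge0 u; have := normr_ge0 v; lra.
have v0 : `|0 : V| <= `|v| by rewrite normr0.
have dFt t w : 0 <= t <= h -> `|w| <= `|v| ->
    differentiable F (x + h *: w + t *: u).
  move=> /small tw /tw; rewrite lt_min => /andP[twd _].
  apply: dF; rewrite -ball_normE /ball_ /= -normrN opprB.
  by rewrite -[x + _ + _]addrA [x + _]addrC addrK addrC.
(* The null vector [h *: 0] lets one statement cover both sides of the
   parallelogram. *)
pose psi t := F (x + h *: v + t *: u) - F (x + h *: 0 + t *: u).
pose dpsi t := G (x + h *: v + t *: u) - G (x + h *: 0 + t *: u).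
have psiD t : 0 <= t <= h -> is_derive t (1 : R) psi (dpsi t).
  by move=> th; apply: is_deriveB; apply: is_derive_line; exact: dFt.
have [||t tI] := MVT_segment (f := psi) (df := dpsi) (ltW h0).
- by move=> t tI; apply: psiD; rewrite !ltW ?(itvP tI).
- apply: continuous_in_subspaceT => t /set_mem /= tI.
  by move: tI; rewrite in_itv => /psiD /is_derive_continuous.
have th : 0 <= t <= h by move: tI; rewrite in_itv.
rewrite /psi scaler0 addr0 subr0 scale0r !addr0 => psiE.
rewrite [x + h *: u + h *: v]addrAC.
rewrite (_ : _ - _ - _ - _ = (dpsi t - h * 'D_v G x) * h); last first.
  by rewrite mulrBl -psiE; ring.
rewrite normrM (gtr0_norm h0) [leRHS]mulrA ler_pM2r//.
have est w : `|w| <= `|v| ->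
    `|G (x + h *: w + t *: u) - G x - L (t *: u + h *: w)|
    <= e / C * (h * (`|u| + `|v|)).
  move=> wv; rewrite -[x + _ + _]addrA [h *: w + _]addrC.
  have := small _ th _ wv; rewrite lt_min => /andP[_ /Gerr /le_trans]; apply.
  by rewrite ler_pM2l// bnd.
have -> : dpsi t - h * 'D_v G x =
    (G (x + h *: v + t *: u) - G x - L (t *: u + h *: v)) -
    (G (x + h *: 0 + t *: u) - G x - L (t *: u + h *: 0)).
  rewrite /dpsi deriveE// -/L scaler0 !linearD !linearZ /= raddf0.
  by rewrite /GRing.scale /=; ring.
apply: le_trans (ler_normB _ _) _; apply: le_trans (lerD (est _ _) (est _ _)) _ => //.
rewrite -mulrDr mulrAC ler_pdivrMr// -!mulrA ler_pM2l// /C; lra.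
Unshelve. all: by end_near. Qed.

(** The elimination of the common second difference between two estimates that
    subtract its middle terms [b] and [c] in opposite orders. *)
Lemma second_order_gap {a b c d k p q e : R} :
  `|a - c - (b - d) - k * p| <= e -> `|a - b - (c - d) - k * q| <= e ->
  `|k * (p - q)| <= e + e.
Proof.
move=> hp hq; have -> : k * (p - q) =
    (a - b - (c - d) - k * q) - (a - c - (b - d) - k * p) by ring.
exact: le_trans (ler_normB _ _) (lerD hq hp).
Qed.

(** Symmetry of second derivatives: the second difference is symmetric in [u]
    and [v], and both mixed derivatives are its limit divided by [h ^+ 2]. *)
Lemma derive_sym {V : normedModType R} {F : V -> R} {x u v : V} :
  (\forall z \near x, differentiable F z) ->
  differentiable ('D_u F) x -> differentiable ('D_v F) x ->
  'D_v ('D_u F) x = 'D_u ('D_v F) x.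
Proof.
move=> dF dDu dDv; apply/eqP; rewrite -subr_eq0 -normr_le0.
apply/ler_addgt0Pl => e e0; rewrite addr0.
have e20 : 0 < e / 2 by rewrite divr_gt0.
have nu := second_difference (v := v) dF dDu _ e20.
have nv := second_difference (v := u) dF dDv _ e20.
have [h [h0 [hu hv]]] := filter_ex (filterI (nbhs_right_gt (0 : R)) (filterI nu nv)).
have h20 : 0 < h ^+ 2 by rewrite exprn_gt0.
rewrite -(ler_pM2l h20) -{1}(gtr0_norm h20) -normrM.
rewrite [x + h *: v + h *: u]addrAC in hv.
have := second_order_gap hu hv; rewrite -mulrDl -splitr.
by rewrite [h ^+ 2 * e]mulrC.
Qed.

Lemma is_derive_entry {n} {w : R -> 'rV[R]_n} {s : R} (j : 'I_n) :
  differentiable w s ->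
  is_derive s (1 : R) (fun t => w t 0 j) (derive1 w s 0 j).
Proof.
move=> /diff_derivable dw; rewrite derive1E derive_mx; last exact: dw.
by rewrite mxE; apply/derivableP/(derivable_mxP w s 1).1/dw.
Qed.

Lemma diff_rV_sum {n} {F : 'rV[R]_n -> R} {x w : 'rV[R]_n} :
  differentiable F x -> 'd F x w = \sum_j w 0 j * 'D_(delta_mx 0 j) F x.
Proof.
move=> dF; rewrite [w in LHS]row_sum_delta linear_sum /=.
by apply: eq_bigr => j _; rewrite linearZ deriveE.
Qed.

Lemma derive_comp {U V W : normedModType R} {g : V -> W} {h : U -> V} {x u : U} :
  differentiable h x -> differentiable g (h x) ->
  'D_u (g \o h) x = 'd g (h x) ('d h x u).
Proof.
move=> dh dg; transitivity ('d (g \o h) x u).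
  exact/deriveE/differentiable_comp.
exact: (congr1 (fun k : U -> W => k u) (diff_comp dh dg)).
Qed.

Lemma is_derive_comp_curve {V W : normedModType R} {G : V -> W} {y : R -> V} {s : R} :
  differentiable G (y s) -> differentiable y s ->
  is_derive s (1 : R) (G \o y) ('d G (y s) (derive1 y s)).
Proof.
move=> dG dy; have dc : differentiable (G \o y) s by exact: differentiable_comp.
apply: DeriveDef; first exact: diff_derivable.
by rewrite derive_comp// derive1E deriveE.
Qed.

(** A differential applied to a moving vector at a moving point is the sum of the
    partial derivatives weighted by the components of the vector, a sum of products
    of real functions to which Leibniz's rule applies. *)
Lemma is_derive_diff_curve {n} {F : 'rV[R]_n -> R} {y w : R -> 'rV[R]_n} {s : R} :
  (\forall z \near y s, differentiable F z) ->
  (forall v, differentiable ('D_v F) (y s)) ->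
  differentiable y s -> differentiable w s ->
  is_derive s (1 : R) (fun t => 'd F (y t) (w t))
    ('d F (y s) (derive1 w s) +
     \sum_j w s 0 j * 'd ('D_(delta_mx 0 j) F) (y s) (derive1 y s)).
Proof.
move=> dF dDF dy dw.
pose h j t := w t 0 j * 'D_(delta_mx 0 j) F (y t).
apply: (@near_eq_is_derive _ _ _ (\sum_j h j)).
  have : \forall t \near s, differentiable F (y t) by apply: (differentiable_continuous dy) dF.
  apply: filterS => t /= dFt.
  by rewrite diff_rV_sum// fct_sumE.
rewrite (diff_rV_sum (nbhs_singleton dF)) -big_split /=.
apply: is_derive_sum => j; rewrite addrC.
have H := is_deriveM (is_derive_entry j dw) (is_derive_comp_curve (dDF (delta_mx 0 j)) dy).
apply: is_derive_eq H _.
by rewrite /GRing.scale /= [X in _ + X = _]mulrC.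
Qed.

(** * Functions on an interval *)

Lemma is_derive0_cst {I : set R} {g : R -> R} : is_interval I ->
  (forall s, I s -> is_derive s (1 : R) g 0) ->
  forall s t, I s -> I t -> g s = g t.
Proof.
move=> itvI dg; suff lt s t : I s -> I t -> s < t -> g s = g t.
  by move=> s t Is It; case: (ltgtP s t) => [/lt->|/lt->|->].
move=> Is It st.
have sub z : s <= z <= t -> I z by exact: itvI.
have [||z zI] := MVT (f := g) (df := fun=> 0) st.
- by move=> z zI; apply/dg/sub; rewrite !ltW ?(itvP zI).
- apply: continuous_in_subspaceT => z /set_mem /=.
  by rewrite in_itv => /sub/dg/is_derive_continuous.
by rewrite mul0r => /eqP; rewrite subr_eq0 => /eqP.
Qed.

Lemma nonvanishing_sg {I : set R} {g : R -> R} : is_interval I ->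
  (forall s, I s -> {for s, continuous g}) -> (forall s, I s -> g s != 0) ->
  forall s t, I s -> I t -> Num.sg (g s) = Num.sg (g t).
Proof.
move=> itvI cg g0; suff lt s t : I s -> I t -> s < t -> Num.sg (g s) = Num.sg (g t).
  by move=> s t Is It; case: (ltgtP s t) => [/lt->|/lt->|->].
move=> Is It st.
have sub z : s <= z <= t -> I z by exact: itvI.
have cgst : {within `[s, t], continuous g}.
  by apply: continuous_in_subspaceT => z /set_mem /=; rewrite in_itv => /sub/cg.
have ivt := IVT (v := 0) (ltW st) cgst.
have absurd : Num.min (g s) (g t) <= 0 <= Num.max (g s) (g t) -> False.
  by move=> /ivt[z]; rewrite in_itv => /sub/g0 gz gz0; rewrite gz0 eqxx in gz.
case: (ltgtP (g s) 0) (g0 _ Is) => // gs _; case: (ltgtP (g t) 0) (g0 _ It) => // gt _.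
- by rewrite !ltr0_sg.
- by exfalso; apply: absurd; rewrite ge_min le_max (ltW gs) (ltW gt) ?orbT.
- by exfalso; apply: absurd; rewrite ge_min le_max (ltW gs) (ltW gt) ?orbT.
- by rewrite !gtr0_sg.
Qed.
End Calculus.

(** * Bilinear forms as matrices *)

Section LinearAlgebra.
Context {R : realType}.

Lemma posdef_unitmx {n} {G : 'M[R]_n} :
  (forall u : 'rV[R]_n, u != 0 -> 0 < (u *m G *m u^T) 0 0) -> G \in unitmx.
Proof.
move=> posG; rewrite -row_free_unit; apply/row_freeP/row_freeP.
rewrite -kermx_eq0; apply/eqP/row_matrixP => i; rewrite row0.
apply/eqP; apply: contraT => /posG.
by rewrite -row_mul mulmx_ker row0 mul0mx mxE ltxx.
Qed.

(** Polarization, on the standard basis. *)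
Lemma quadratic_form0 {n} {H : 'M[R]_n} : H^T = H ->
  (forall u : 'rV[R]_n, (u *m H *m u^T) 0 0 = 0) -> H = 0.
Proof.
move=> symH H0; apply/matrixP => i j; rewrite mxE.
have E a b : ((delta_mx 0 a : 'rV_n) *m H *m (delta_mx 0 b : 'rV_n)^T) 0 0 = H a b.
  by rewrite -rowE trmx_delta -colE !mxE.
have := H0 (delta_mx 0 i + delta_mx 0 j).
rewrite linearD /= !mulmxDl !mulmxDr.
have addE (A C : 'M[R]_1) : (A + C) 0 0 = A 0 0 + C 0 0 by rewrite mxE.
rewrite !addE !E.
have Hii k : H k k = 0 by rewrite -E H0.
have Hji : H j i = H i j by rewrite -[in LHS]symH mxE.
rewrite Hji !Hii; lra.
Qed.

End LinearAlgebra.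

(** * Charts of a manifold *)

Section Geometry.
Context {R : realType} {n : nat} {M : topologicalType} {S : riemannian R n M}.
Context (hM : riemannian_manifold S).

Lemma paramK p q : dom S p q -> param S p (coord S p q) = q.
Proof. by case: hM => _ _ [/(_ p)[_ _ h _ _] _ _] _; exact: h. Qed.

Lemma dom_self p : dom S p p.
Proof. by case: hM => _ _ []. Qed.

Lemma open_dom p : open (dom S p).
Proof. by case: hM => _ _ [/(_ p)[]]. Qed.

Lemma nbhs_dom p q : dom S p q -> nbhs q (dom S p).
Proof. by move=> pq; exact: open_nbhs_nbhs (conj (open_dom p) pq). Qed.

Lemma coord_dom_coord p q : dom S p q -> coord_dom S p (coord S p q).
Proof. by exists q. Qed.

Lemma nbhs_coord_dom p q : dom S p q -> nbhs (coord S p q) (coord_dom S p).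
Proof.
move=> pq; apply: open_nbhs_nbhs; split; last exact: coord_dom_coord.
by case: hM => _ _ [/(_ p)[]].
Qed.

Lemma near_coordK p q : dom S p q ->
  \forall x \near coord S p q, coord S p (param S p x) = x.
Proof. by move=> /nbhs_coord_dom; apply: filterS => x [r pr <-]; rewrite paramK. Qed.

Lemma near_param p q (U : set M) : dom S p q -> nbhs q U ->
  \forall x \near coord S p q, U (param S p x).
Proof.
move=> pq Uq.
have cp : {for coord S p q, continuous (param S p)}.
  by case: hM => _ _ [/(_ p)[_ _ _ _ h] _ _] _; exact/h/coord_dom_coord.
by apply: cp; rewrite /= paramK.
Qed.

Lemma differentiable_transition p q r : dom S p r -> dom S q r ->
  differentiable (coord S q \o param S p) (coord S p r).
Proof.
move=> pr qr; case: hM => _ _ [_ _ /(_ p q 1%N)[/= h _]] _.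
by apply: h; exists r.
Qed.

Lemma to_chart_id p u : to_chart S p p u = u.
Proof.
have pp := dom_self p; rewrite /to_chart -deriveE; last exact: differentiable_transition.
by rewrite (near_eq_derive (g := id)) ?derive_id//; exact: near_coordK.
Qed.

(** * Symmetries of the metric and of the connection *)

Lemma inner_sym p u v : inner S p u v = inner S p v u.
Proof.
have symG : (metric S p)^T = metric S p by case: hM => _ _ _ [].
have -> : inner S p v u = (u *m metric S p *m v^T)^T 0 0.
  by rewrite !trmx_mul trmxK symG mulmxA.
by rewrite [RHS]mxE.
Qed.

Lemma gram_sym p x i j : gram S p x i j = gram S p x j i.
Proof. by rewrite !mxE inner_sym. Qed.

Lemma christoffel_sym p x k i j : christoffel S p x k i j = christoffel S p x k j i.
Proof.
rewrite /christoffel; congr (_ * _); apply: eq_bigr => l _; congr (_ * _).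
have -> : (fun y => gram S p y j i) = (fun y => gram S p y i j).
  by apply: funext => y; exact: gram_sym.
by rewrite [X in X - _]addrC.
Qed.

(** * Curves in charts *)

Section Curve.
Context {I : set R} {c : R -> M}.
Context (hc : smooth_curve S I c).

Lemma near_curve_dom p s : I s -> dom S p (c s) -> \forall t \near s, dom S p (c t).
Proof. by move=> Is ps; apply: hc.1 => //; exact: nbhs_dom. Qed.

Lemma differentiable_coord_curve p s : I s -> dom S p (c s) ->
  differentiable (coord S p \o c) s.
Proof. by move=> Is ps; case: hc => _ /(_ p 1%N)[/= h _]; exact: h. Qed.

Lemma differentiable_derive1_coord_curve p s : I s -> dom S p (c s) ->
  differentiable (derive1 (coord S p \o c)) s.
Proof.
move=> Is ps; case: hc => _ /(_ p 2%N)[_ /(_ 1)[/= h _]].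
have -> : derive1 (coord S p \o c) = 'D_1 (coord S p \o c).
  by apply: funext => t; rewrite derive1E.
exact: h.
Qed.

(** The velocity is computed in a chart that moves with the point; seen from a
    fixed chart it is the ordinary derivative of the coordinates, which can be
    differentiated once more. *)
Lemma to_chart_velocity p s : I s -> dom S p (c s) ->
  to_chart S p (c s) (velocity S c s) = derive1 (coord S p \o c) s.
Proof.
move=> Is ps; have cs := dom_self (c s).
have dt := differentiable_transition _ _ _ cs ps.
have dc := differentiable_coord_curve _ _ Is cs.
have [_ dE] := is_derive_comp_curve (y := coord S (c s) \o c) dt dc.
rewrite [LHS](esym dE).
rewrite derive1E; apply: near_eq_derive.
by have := near_curve_dom _ _ Is cs; apply: filterS => t ct /=; rewrite paramK.
Qed.

End Curve.

(** * The Hessian of a smooth function *)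

Section Function.
Context {f : M -> R}.
Context (hf : smooth_function S f).

Lemma differentiable_local p q : dom S p q -> differentiable (f \o param S p) (coord S p q).
Proof. by move=> pq; case: (hf p 1%N) => /= h _; exact/h/coord_dom_coord. Qed.

Lemma near_differentiable_local p q : dom S p q ->
  \forall x \near coord S p q, differentiable (f \o param S p) x.
Proof. by move=> /nbhs_coord_dom; apply: filterS; case: (hf p 1%N). Qed.

Lemma differentiable_derive_local p q v : dom S p q ->
  differentiable ('D_v (f \o param S p)) (coord S p q).
Proof.
by move=> pq; case: (hf p 2%N) => _ /(_ v)[/= h _]; exact/h/coord_dom_coord.
Qed.

(** Invariance of the differential under change of charts: it moves the
    computation along a curve into one fixed chart. *)
Lemma dfun_chart p q u : dom S p q ->
  dfun S f q u = 'd (f \o param S p) (coord S p q) (to_chart S p q u).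
Proof.
move=> pq; have qq := dom_self q.
have dt := differentiable_transition _ _ _ qq pq.
have tq : (coord S p \o param S q) (coord S q q) = coord S p q.
  by rewrite /comp (paramK _ _ qq).
have dl : differentiable (f \o param S p) ((coord S p \o param S q) (coord S q q)).
  by rewrite tq; exact: differentiable_local.
have dq := differentiable_local _ _ qq.
transitivity ('D_u (f \o param S q) (coord S q q)); first exact/esym/deriveE.
transitivity ('D_u ((f \o param S p) \o (coord S p \o param S q)) (coord S q q)).
  apply: near_eq_derive.
  have := near_param _ _ _ qq (nbhs_dom _ _ pq).
  by apply: filterS => x px; rewrite /comp (paramK _ _ px).
by rewrite -tq; exact: derive_comp.
Qed.

(** The coordinate expression of the covariant derivative of [df], evaluated at
    the centre [p] of its own chart only. *)
Definition hessian p : 'M[R]_n := \matrix_(i, j)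
  ('D_(delta_mx 0 i) ('D_(delta_mx 0 j) (f \o param S p)) (coord S p p) -
   \sum_k christoffel S p (coord S p p) k i j *
          'D_(delta_mx 0 k) (f \o param S p) (coord S p p)).

Lemma hessian_sym p : (hessian p)^T = hessian p.
Proof.
apply/matrixP => i j; rewrite [LHS]mxE.
rewrite [LHS]mxE [RHS]mxE.
have E : 'D_(delta_mx 0 j) ('D_(delta_mx 0 i) (f \o param S p)) (coord S p p) =
    'D_(delta_mx 0 i) ('D_(delta_mx 0 j) (f \o param S p)) (coord S p p).
  have pp := dom_self p.
  exact: (derive_sym (near_differentiable_local _ _ pp)
    (differentiable_derive_local _ _ _ pp) (differentiable_derive_local _ _ _ pp)).
rewrite E; congr (_ - _).
by apply: eq_bigr => k _; rewrite christoffel_sym.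
Qed.

(** In the chart at [c s], the product rule produces the second partial
    derivatives of [f] and the differential of the componentwise derivative of
    [V]; the Christoffel terms added by [covd] are those subtracted in
    [hessian]. *)
Lemma is_derive_dfun {I : set R} {c : R -> M} {V : R -> 'rV[R]_n} {s : R} :
  smooth_curve S I c -> I s ->
  differentiable (fun t => to_chart S (c s) (c t) (V t)) s ->
  is_derive s (1 : R) (fun t => dfun S f (c t) (V t))
    ((velocity S c s *m hessian (c s) *m (V s)^T) 0 0
     + dfun S f (c s) (covd S c V s)).
Proof.
move=> hc Is dw; have ps := dom_self (c s).
set p := c s in dw ps *.
have dy : differentiable (coord S p \o c) s by exact: (differentiable_coord_curve hc).
have := is_derive_diff_curve (near_differentiable_local _ _ ps)
  (fun v => differentiable_derive_local _ _ v ps) dy dw.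
move=> H; apply: (@near_eq_is_derive _ _ _ (fun t =>
    'd (f \o param S p) ((coord S p \o c) t) (to_chart S p (c t) (V t)))).
  have := near_curve_dom hc _ _ Is ps.
  by apply: filterS => t pt; rewrite (dfun_chart p).
apply: is_derive_eq H _.
rewrite /= -/p to_chart_id.
rewrite /covd -/p /dfun linearD /= addrCA; congr (_ + _).
have dF := differentiable_local _ _ ps.
rewrite [X in _ = _ + X](diff_rV_sum dF).
rewrite mxE /=.
under eq_bigr => j _ do rewrite (diff_rV_sum (differentiable_derive_local _ _ _ ps)).
rewrite [X in _ = _ + X](_ : _ = \sum_j \sum_i velocity S c s 0 i * V s 0 j *
   \sum_k christoffel S p (coord S p p) k i j * 'D_(delta_mx 0 k) (f \o param S p) (coord S p p)).
  rewrite -big_split /=; apply: eq_bigr => j _.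
  rewrite !mxE mulr_suml mulr_sumr -big_split /=.
  apply: eq_bigr => i _; rewrite !mxE -/(velocity S c s) /velocity -/p; ring.
under eq_bigr => k _ do rewrite mxE mulr_suml.
rewrite exchange_big /= [RHS]exchange_big /=; apply: eq_bigr => i _.
under eq_bigr => k _ do rewrite mulr_suml.
rewrite exchange_big /=; apply: eq_bigr => j _.
rewrite mulr_sumr; apply: eq_bigr => k _; ring.
Qed.

Lemma is_derive_comp_smooth_curve {I : set R} {c : R -> M} {s : R} :
  smooth_curve S I c -> I s ->
  is_derive s (1 : R) (f \o c) (dfun S f (c s) (velocity S c s)).
Proof.
move=> hc Is; have ps := dom_self (c s).
have dy := differentiable_coord_curve hc _ _ Is ps.
have dF := differentiable_local _ _ ps.
apply: near_eq_is_derive (is_derive_comp_curve dF dy).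
have := near_curve_dom hc _ _ Is ps.
by apply: filterS => t pt /=; rewrite paramK.
Qed.

(** Along the geodesic with initial velocity [u], which completeness provides,
    the derivative of [f] is constant; the product rule for the parallel field
    of velocities then leaves only the value of the Hessian at [u].  Symmetry
    turns the vanishing of the quadratic form into that of the bilinear one. *)
Lemma affine_hessian0 : complete_riemannian S -> affine_function S f ->
  forall p, hessian p = 0.
Proof.
move=> hS haff p; apply: quadratic_form0 (hessian_sym p) _ => u.
have [c [gc c0 vc]] := hS p u.
have [a [b fc]] := haff _ _ gc.
case: gc => _ hc cov0.
have IT t : [set: R] t by [].
have df t : dfun S f (c t) (velocity S c t) = a.
  have [_ <-] := is_derive_comp_smooth_curve hc (IT t).
  rewrite (_ : f \o c = fun t => a * t + b); last by apply: funext => r; exact: fc.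
  have : is_derive t (1 : R) (fun t => a * t + b) (a *: 1 + 0).
    exact: is_deriveD.
  by case=> _ ->; rewrite addr0 /GRing.scale /= mulr1.
have dv : differentiable (fun t => to_chart S (c 0) (c t) (velocity S c t)) 0.
  have ps := dom_self (c 0).
  apply/derivable1_diffP.
  have := near_curve_dom hc _ _ (IT 0) ps.
  have /derivable1_diffP := differentiable_derive1_coord_curve hc _ _ (IT 0) ps.
  move=> dd nr; apply: near_eq_derivable dd.
  by apply: filterS nr => t pt; rewrite (to_chart_velocity hc).
have := is_derive_dfun hc (IT 0) dv.
rewrite (_ : (fun t => _) = cst a); last by apply: funext => t; exact: df.
move=> [_]; rewrite derive_cst cov0// /dfun linear0 addr0 c0 vc => <-.
by [].
Qed.

End Function.

(** * Gradients and orthonormal frames *)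

(** A positive definite Gram matrix is invertible, so the differential has a
    representing vector and [grad] does not fall back on its default value. *)
Lemma inner_grad (f : M -> R) p u : inner S p (grad S f p) u = dfun S f p u.
Proof.
rewrite /grad; set P := (X in xget _ X).
suff : P (xget 0 P) by move=> ->.
apply: xgetPex.
have Gu : metric S p \in unitmx.
  by apply: posdef_unitmx => v; case: hM => _ _ _ [_ h _]; exact: h.
exists ((\row_j dfun S f p (delta_mx 0 j)) *m invmx (metric S p)) => v /=.
rewrite /inner mulmxKV// mxE /dfun [v in LHS]row_sum_delta linear_sum /=.
by apply: eq_bigr => j _; rewrite !mxE linearZ /= mulrC.
Qed.

(** If the rows of the square matrix [E] are orthonormal for the metric [G] then
    [E G E^T = 1], hence also [G E^T E = 1], and this second identity is the
    expansion. *)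
Lemma orthonormal_expansion p (e : 'I_n -> 'rV[R]_n) v :
  (forall i j, inner S p (e i) (e j) = (i == j)%:R) ->
  v = \sum_i inner S p v (e i) *: e i.
Proof.
move=> he; pose E : 'M[R]_n := \matrix_i e i.
have coef u i : (u *m metric S p *m E^T) 0 i = inner S p u (e i).
  by rewrite /inner -(rowK e i) -/E tr_row colE mulmxA -colE [RHS]mxE.
have EGE : E *m (metric S p *m E^T) = 1%:M.
  apply/matrixP => i j; rewrite [RHS]mxE -he -coef mulmxA.
  by rewrite -(rowK e i) -/E -!row_mul [RHS]mxE.
rewrite -[LHS]mulmx1 -(mulmx1C EGE) !mulmxA mulmx_sum_row.
by apply: eq_bigr => i _; rewrite coef rowK.
Qed.

(** The gradient of a function with zero Hessian is parallel: only the derivative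
    of the other factor remains. *)
Lemma is_derive_inner_grad {f : M -> R} (hf : smooth_function S f)
    (hf0 : forall p, hessian (f := f) p = 0)
    {I : set R} {c : R -> M} {V : R -> 'rV[R]_n} {s : R} :
  smooth_curve S I c -> smooth_field S I c V -> I s ->
  is_derive s (1 : R) (fun t => inner S (c t) (grad S f (c t)) (V t))
    (inner S (c s) (grad S f (c s)) (covd S c V s)).
Proof.
move=> hc hV Is.
have dV : differentiable (fun t => to_chart S (c s) (c t) (V t)) s.
  have [/= dV _] := hV (c s) 1%N; apply: dV; split=> //; exact: dom_self.
have := is_derive_dfun hf hc Is dV.
rewrite hf0 mulmx0 mul0mx mxE add0r inner_grad => H.
by rewrite (_ : (fun t => _) = (fun t => dfun S f (c t) (V t)))//;
  apply: funext => t; rewrite inner_grad.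
Qed.

End Geometry.

(** * Slant helices *)

(** Here [a] and [b] are the components of a parallel vector on [T] and [B], whose
    component on [N] is the constant [c].  The relation [kappa a = tau b] makes
    [(a, b)] proportional to [(tau, kappa)] and [a^2 + b^2] constant, so the factor
    of proportionality to the unit vector is constant up to sign; the sign is that
    of [b], which has no zero.  The curvature function in the last claim is the
    derivative of [tau / kappa = a / b] expressed through this factor. *)
Lemma slant_helix_ode {R : realType} {I : set R} {a b kappa tau : R -> R} {c : R} :
  open_interval I -> c != 0 -> (forall s, I s -> 0 < kappa s) ->
  (forall s, I s -> is_derive s (1 : R) a (kappa s * c)) ->
  (forall s, I s -> is_derive s (1 : R) b (- tau s * c)) ->
  (forall s, I s -> kappa s * a s = tau s * b s) ->
  exists n : R, n != 0 /\ forall s, I s ->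
    let w := Num.sqrt (tau s ^+ 2 + kappa s ^+ 2) in
    [/\ a s = n * tau s / w, b s = n * kappa s / w &
        kappa s ^+ 2 / (tau s ^+ 2 + kappa s ^+ 2) `^ (3 / 2)
          * derive1 (fun t => tau t / kappa t) s = c / n].
Proof.
move=> [oI itvI [s0 Is0]] c0 kgt0 da db alg.
have near_I s : I s -> \forall t \near s, I t by move=> Is; exact: open_nbhs_nbhs.
have k0 s : I s -> kappa s != 0 by move=> /kgt0/lt0r_neq0.
pose q : R -> R := a * a + b * b.
have dq s : I s -> is_derive s (1 : R) q 0.
  move=> Is; have ha := da _ Is; have hb := db _ Is.
  have := is_deriveD (is_deriveM ha ha) (is_deriveM hb hb).
  move=> H; apply: is_derive_eq H _; rewrite /GRing.scale /=.
  have -> : a s * (kappa s * c) = (kappa s * a s) * c by ring.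
  rewrite (alg _ Is); ring.
have qcst s t : I s -> I t -> q s = q t by exact: is_derive0_cst dq s t.
have qE s : q s = a s ^+ 2 + b s ^+ 2 by [].
(* A zero of [b] is a zero of [a], hence [a] vanishes on [I], against
   [a' = kappa c]. *)
have b0 s : I s -> b s != 0.
  move=> Is; apply/negP => /eqP bs0.
  have as0 : a s = 0.
    by apply/eqP; have /eqP := alg _ Is; rewrite bs0 mulr0 mulf_eq0 (negbTE (k0 _ Is)).
  have a0 t : I t -> a t = 0.
    move=> It; have := qcst _ _ It Is; rewrite !qE as0 bs0 expr0n addr0 /= => /eqP.
    by rewrite paddr_eq0 ?sqr_ge0// sqrf_eq0 => /andP[/eqP].
  have acst : \forall t \near s, a t = (cst 0 : R -> R) t.
    by apply: filterS (near_I _ Is) => t /a0.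
  have [_] := near_eq_is_derive acst (da _ Is); rewrite derive_cst => /eqP.
  by rewrite eq_sym mulf_eq0 (negbTE c0) (negbTE (k0 _ Is)).
pose w s := Num.sqrt (tau s ^+ 2 + kappa s ^+ 2).
have ww s : w s ^+ 2 = tau s ^+ 2 + kappa s ^+ 2.
  by rewrite sqr_sqrtr// addr_ge0// sqr_ge0.
have w_gt0 s : I s -> 0 < w s.
  by move=> Is; rewrite sqrtr_gt0 ltr_wpDl ?sqr_ge0// exprn_gt0// kgt0.
have aE s : I s -> a s = tau s * b s / kappa s.
  by move=> Is; rewrite -(alg _ Is) mulrC mulKf// k0.
(* The signed length of [(a, b)], which will be the constant [n]. *)
pose m s := b s * w s / kappa s.
have mE s : I s -> m s = Num.sg (b s) * Num.sqrt (q s).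
  move=> Is; have kk := k0 _ Is.
  have -> : q s = m s ^+ 2.
    by rewrite qE (aE _ Is) /m !exprMn exprVn ww; field.
  rewrite sqrtr_sqr /m -mulrA normrM [RHS]mulrA mulr_sg_norm ger0_norm//.
  by rewrite ltW// divr_gt0 ?w_gt0 ?kgt0.
have cb s : I s -> {for s, continuous b} by move=> /db/is_derive_continuous.
have mcst s : I s -> m s = m s0.
  move=> Is; rewrite !mE// (qcst _ _ Is Is0).
  by rewrite (nonvanishing_sg itvI cb b0 _ _ Is Is0).
have m0 s : I s -> m s != 0.
  by move=> Is; rewrite /m !mulf_neq0 ?invr_neq0 ?b0 ?k0// gt_eqF ?w_gt0.
exists (m s0); split; first exact: m0.
move=> s Is; rewrite -(mcst _ Is) -/(w s) /=.
have kk := k0 _ Is; have bb := b0 _ Is.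
have w0 : w s != 0 by rewrite gt_eqF ?w_gt0.
have bE : b s = m s * kappa s / w s by rewrite /m; field; rewrite kk w0.
split; [|exact: bE|].
  by rewrite (aE _ Is) {1}bE; field; rewrite kk w0.
have ha := da _ Is; have hb := db _ Is.
have nE : \forall t \near s, tau t / kappa t = (a * (fun y => (b y)^-1)) t.
  apply: filterS (near_I _ Is) => t It; rewrite fctE /= (aE _ It).
  by field; rewrite k0// b0.
rewrite derive1E (near_eq_derive _ nE).
have [_ ->] := is_deriveM ha (is_deriveV bb hb).
rewrite /GRing.scale /=.
have -> : (tau s ^+ 2 + kappa s ^+ 2) `^ (3 / 2) = w s ^+ 3.
  have ge0 : 0 <= tau s ^+ 2 + kappa s ^+ 2 by rewrite -ww sqr_ge0.
  by rewrite mulrC powRrM powR12_sqrt// powR_mulrn// sqrtr_ge0.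
rewrite (aE _ Is) /m; have := ww s; move: (w s) w0 => v v0 vE.
have -> : c / (b s * v / kappa s) = kappa s * c * v ^+ 2 / (b s * v ^+ 3).
  by field; rewrite kk v0 bb.
rewrite vE; field; by rewrite kk v0 bb.
Qed.

Theorem theorem2p1 (R : realType) (M : topologicalType) (S : riemannian R 3 M)
    (hM : riemannian_manifold S)
    (hconn : connected [set: M])
    (hcomplete : complete_riemannian S)
    (hprod : exists (P : topologicalType) (SP : riemannian R 2 P),
       riemannian_manifold SP /\ isometric S (prod_line SP))
    (f : M -> R)
    (hsmooth : smooth_function S f)
    (haffine : affine_function S f)
    (hnontrivial : nontrivial_function f)
    (I : set R) (alpha : R -> M) (T N B : R -> 'rV[R]_3) (kappa tau : R -> R)
    (hfrenet : frenet_curve S I alpha T N B kappa tau)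
    (hhelix : eikonal_slant_helix S f I alpha N)
    (costheta : R)
    (hcos : forall s, I s ->
       inner S (alpha s) (grad S f (alpha s)) (N s) = costheta) :
  (exists C : R, forall s, I s ->
     kappa s ^+ 2 / (tau s ^+ 2 + kappa s ^+ 2) `^ (3 / 2)
       * derive1 (fun t => tau t / kappa t) s = C) /\
  (exists n : R, n != 0 /\ forall s, I s ->
     grad S f (alpha s) =
       (n * tau s / Num.sqrt (tau s ^+ 2 + kappa s ^+ 2)) *: T s
       + costheta *: N s
       + (n * kappa s / Num.sqrt (tau s ^+ 2 + kappa s ^+ 2)) *: B s).
Proof.
case: hfrenet => -[hI halpha] _ [fT fN fB] ortho frenet.
have [oI itvI [s0 Is0]] := hI.
have c0 : costheta != 0.
  by case: hhelix => _ [c [c0 hc]]; rewrite -(hcos _ Is0) hc.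
have hess0 := affine_hessian0 hM hsmooth hcomplete haffine.
pose coef V s := inner S (alpha s) (grad S f (alpha s)) (V s).
have dcoef V s : smooth_field S I alpha V -> I s -> is_derive s (1 : R) (coef V)
    (inner S (alpha s) (grad S f (alpha s)) (covd S alpha V s)).
  by move=> hV Is; exact: (is_derive_inner_grad hM hsmooth hess0 halpha hV Is).
have innerZ p u (x : R) v : inner S p u (x *: v) = x * inner S p u v.
  by rewrite /inner linearZ /= -scalemxAr mxE.
have innerD p u v1 v2 : inner S p u (v1 + v2) = inner S p u v1 + inner S p u v2.
  by rewrite /inner linearD /= mulmxDr mxE.
have dT s : I s -> is_derive s (1 : R) (coef T) (kappa s * costheta).
  move=> Is; have := dcoef _ _ fT Is.
  by have [_ -> _ _] := frenet _ Is; rewrite innerZ hcos.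
have dB s : I s -> is_derive s (1 : R) (coef B) (- tau s * costheta).
  move=> Is; have := dcoef _ _ fB Is.
  by have [_ _ _ ->] := frenet _ Is; rewrite innerZ hcos.
have alg s : I s -> kappa s * coef T s = tau s * coef B s.
  move=> Is; have := dcoef _ _ fN Is.
  have [_ _ -> _] := frenet _ Is; rewrite innerD !innerZ => dN.
  have Ncst : \forall t \near s, coef N t = (cst costheta : R -> R) t.
    have nI : \forall t \near s, I t by exact: open_nbhs_nbhs.
    by apply: filterS nI => t It; exact: hcos.
  have [_] := near_eq_is_derive Ncst dN; rewrite derive_cst -/(coef T s) -/(coef B s).
  by move=> /eqP; rewrite mulNr addrC eq_sym subr_eq0 => /eqP.
have kgt0 s : I s -> 0 < kappa s by move=> /frenet[].
have [n [n0 hn]] := slant_helix_ode hI c0 kgt0 dT dB alg.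
split; first by exists (costheta / n) => s /hn[].
exists n; split=> // s Is; have [/= <- <- _] := hn _ Is.
pose e (i : 'I_3) := [:: T s; N s; B s]`_i.
have [[TT NN BB] [TN TB NB]] := ortho _ Is.
have he i j : inner S (alpha s) (e i) (e j) = (i == j)%:R.
  case: i => [[|[|[|//]]] ?]; case: j => [[|[|[|//]]] ?];
    by rewrite /e /= ?TT ?NN ?BB ?TN ?TB ?NB // inner_sym.
rewrite [LHS](orthonormal_expansion _ e _ he) !big_ord_recl big_ord0 addr0 addrA /e /=.
by rewrite hcos.
Qed.
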